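(* Let $(X,d,\mu)$ be an irreversible metric measure space which has normal concentration, i.e. there are positive constants $C$ and $c$ such that $\alpha_{(X,d,\mu)}(r)\le Ce^{-cr^2}$ for every $r>0$. Then, for $q\ge 1$, $(X,d,\mu)$ satisfies $(2,q)$-Moment concentration.
   Context: An irreversible metric space $(X,d)$ is a set $X$ with a function $d:X\times X\to[0,\infty)$ such that $d(x_1,x_2)=0$ if and only if $x_1=x_2$, and $d(x_1,x_3)\le d(x_1,x_2)+d(x_2,x_3)$ for all $x_1,x_2,x_3\in X$ ($d$ need not be symmetric). An irreversible metric measure space $(X,d,\mu)$ is an irreversible metric space endowed with a Borel probability measure $\mu$. For $A\subset X$ and $r>0$ put $B^{+}(A,r)=\{x\in X\mid \inf_{z\in A}d(z,x)<r\}$ and $B^{-}(A,r)=\{x\in X\mid \inf_{z\in A}d(x,z)<r\}$. The concentration function is $$\alpha_{(X,d,\mu)}(r)=\sup\left\{1-\min\{\mu(B^{+}(A,r)),\mu(B^{-}(A,r))\}\;\middle|\; A\subset X \text{ Borel},\ \mu(A)\ge \tfrac12\right\},\quad r>0.$$ A function $f:X\to\mathbb{R}$ is $L$-Lipschitz ($L>0$) if $f(z)-f(x)\le L\,d(x,z)$ for all $x,z\in X$. The sets $B^{\pm}(A,r)$ and Lipschitz functions are understood to be measurable. Given $p,q\ge 1$, $(X,d,\mu)$ is said to satisfy $(p,q)$-Moment concentration if there is a positive constant $C$ such that for any 1-Lipschitz function $f$, $\left\|f-\int_X f\,d\mu\right\|_{L^q(\mu)}^p\le \frac{q}{C}$.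 *)

(* Defs.v *)
From HB Require Import structures.
From mathcomp Require Import all_boot all_order all_algebra.
From mathcomp Require Import all_classical all_reals all_analysis.
From mathcomp Require Import lra.

Set Implicit Arguments.
Unset Strict Implicit.
Unset Printing Implicit Defensive.

Import Order.TTheory GRing.Theory Num.Theory.
Import numFieldNormedType.Exports.

Local Open Scope classical_set_scope.
Local Open Scope ring_scope.

Record irreversible_metric (R : realType) (X : Type) (d : X -> X -> R) : Prop :=
  IrreversibleMetric {
    imetric_ge0 : forall x y, 0 <= d x y ;
    imetric_eq0 : forall x y, d x y = 0 <-> x = y ;
    imetric_triangle : forall x y z, d x z <= d x y + d y z
  }.

(* A non-symmetric distance induces three topologies, generated respectively
   by the forward balls, the backward balls, and the balls of the symmetrized
   distance max (d x y) (d y x). *)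
Variant ball_kind := Forward | Backward | Symmetrized.

Definition imetric_ball (R : realType) (X : Type) (d : X -> X -> R)
    (k : ball_kind) (x : X) (r : R) : set X :=
  match k with
  | Forward => [set y | d x y < r]
  | Backward => [set y | d y x < r]
  | Symmetrized => [set y | Num.max (d x y) (d y x) < r]
  end.

Definition imetric_open (R : realType) (X : Type) (d : X -> X -> R)
    (k : ball_kind) : set (set X) :=
  [set U | forall x, U x -> exists2 r, 0 < r & imetric_ball d k x r `<=` U].

Notation borelType d k := (g_sigma_algebraType (imetric_open d k)).

(* The infimum is taken in the extended reals, so that both sets are empty
   when A is. *)
Definition fwd_nbhd (R : realType) (X : Type) (d : X -> X -> R)
    (A : set X) (r : R) : set X :=
  [set x | (ereal_inf [set (d z x)%:E | z in A] < r%:E)%E].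

Definition bwd_nbhd (R : realType) (X : Type) (d : X -> X -> R)
    (A : set X) (r : R) : set X :=
  [set x | (ereal_inf [set (d x z)%:E | z in A] < r%:E)%E].

(* One-sided condition: x and z are not interchangeable. *)
Definition ilipschitz (R : realType) (X : Type) (d : X -> X -> R)
    (L : R) (f : X -> R) : Prop :=
  forall x z, f z - f x <= L * d x z.

Section concentration.
Context (R : realType) (X : pointedType) (d : X -> X -> R) (k : ball_kind).
Variable mu : probability (borelType d k) R.
Local Open Scope ereal_scope.

Definition concentration (r : R) : \bar R :=
  ereal_sup [set 1 - Order.min (mu (fwd_nbhd d A r)) (mu (bwd_nbhd d A r))
            | A in [set A : set (borelType d k) |
                     measurable A /\ (2^-1)%:E <= mu A]].

Definition normal_concentration : Prop :=
  exists C c : R, [/\ (0 < C)%R, (0 < c)%R &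
    forall r : R, (0 < r)%R ->
      concentration r <= (C * expR (- (c * r ^+ 2)))%:E].

(* The real-valued integral of a non-integrable function is a default value,
   but the bound makes f - cst m q-integrable for a constant m, and hence,
   since q >= 1, f itself integrable. *)
Definition moment_concentration (p q : R) : Prop :=
  exists2 C : R, (0 < C)%R &
    forall f : X -> R, ilipschitz d 1 f ->
      'N[mu]_(q%:E)[EFin \o (fun x => f x - \int[mu]_y f y)%R] `^ p
        <= (q / C)%:E.

End concentration.

(* The sets and functions occurring above are Borel for each of the three
   topologies, so no measurability hypothesis is needed. *)
Section measurability.
Context (R : realType) (X : pointedType) (d : X -> X -> R) (k : ball_kind).
Hypothesis dm : irreversible_metric d.

Let measurable_open (U : set (borelType d k)) :
  imetric_open d k U -> measurable U.
Proof. exact: sub_sigma_algebra. Qed.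

Lemma fwd_nbhdE (A : set X) r :
  fwd_nbhd d A r = [set x | exists2 z, A z & d z x < r].
Proof.
apply/seteqP; split=> x /=.
  by move=> /ereal_inf_lt[_ [z Az <-]]; rewrite lte_fin => zr; exists z.
move=> [z Az zr]; apply: (@le_lt_trans _ _ (d z x)%:E); last by rewrite lte_fin.
by apply: ereal_inf_lbound; exists z.
Qed.

Lemma bwd_nbhdE (A : set X) r :
  bwd_nbhd d A r = [set x | exists2 z, A z & d x z < r].
Proof.
apply/seteqP; split=> x /=.
  by move=> /ereal_inf_lt[_ [z Az <-]]; rewrite lte_fin => zr; exists z.
move=> [z Az zr]; apply: (@le_lt_trans _ _ (d x z)%:E); last by rewrite lte_fin.
by apply: ereal_inf_lbound; exists z.
Qed.

Lemma measurable_ilipschitz (L : R) (f : borelType d k -> R) :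
  0 < L -> ilipschitz d L f -> measurable_fun setT f.
Proof.
move=> L0 fL.
have lt_fwd a x y : f x < a -> d x y < (a - f x) / L -> f y < a.
  by rewrite ltr_pdivlMr// mulrC => _ /(le_lt_trans (fL x y)); rewrite ltrD2r.
have lt_bwd a x y : a < f x -> d y x < (f x - a) / L -> a < f y.
  rewrite ltr_pdivlMr// mulrC => _ /(le_lt_trans (fL y x)).
  by rewrite ltrD2l ltrN2.
case: (pselect (k = Backward)) => kB.
  move=> mT; apply: (measurability _ (measurable_realfun.RGenOInfty.measurableE R)) => //.
  move=> _ [_ [a ->] <-]; rewrite setTI; apply: measurable_open => x /=.
  rewrite in_itv/= andbT => fxa; exists ((f x - a) / L).
    by rewrite divr_gt0// subr_gt0.
  by rewrite kB => y /= /lt_bwd; rewrite in_itv/= andbT; exact.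
move=> mT; apply: (measurability _ (measurable_realfun.RGenInftyO.measurableE R)) => //.
move=> _ [_ [a ->] <-]; rewrite setTI; apply: measurable_open => x /=.
rewrite in_itv/= => fxa; exists ((a - f x) / L).
  by rewrite divr_gt0// subr_gt0.
have kF y e : imetric_ball d k x e y -> d x y < e.
  by move: kB; case: (k) => //= _; rewrite gt_max => /andP[].
by move=> y /kF /lt_fwd; rewrite /= in_itv; exact.
Qed.

Let measurable_nbhd (delta : X -> X -> R) (A : set X) (r : R) :
  (forall x y z, delta x z <= delta x y + delta y z) ->
  (forall x e, imetric_ball d k x e `<=` [set y | delta x y < e]) \/
  (forall x e, imetric_ball d k x e `<=` [set y | delta y x < e]) ->
  measurable ([set x | exists2 z, A z & delta z x < r] : set (borelType d k)).
Proof.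
move=> tri [ball|ball].
  apply: measurable_open => x [z Az zx].
  exists (r - delta z x); first by rewrite subr_gt0.
  move=> y /ball /= xy; exists z => //.
  by rewrite (le_lt_trans (tri z x y))// -ltrBrDl.
pose V n : set (borelType d k) := [set x | exists2 e, 0 < e &
  forall z, A z -> r - n.+1%:R^-1 + e <= delta z x].
have -> : [set x | exists2 z, A z & delta z x < r] = \bigcup_n ~` V n.
  apply/seteqP; split=> x.
    move=> [z Az zx].
    have : 0 < r - delta z x by rewrite subr_gt0.
    move=> /ltr_add_invr[n]; rewrite add0r => nr; exists n => // -[e e0 /(_ _ Az)].
    by apply/negP; rewrite -ltNge; move: nr e0; move: n.+1%:R^-1 => t; lra.
  move=> [n _ nV]; apply: contrapT => xA; apply: nV.
  exists n.+1%:R^-1; first by rewrite invr_gt0.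
  move=> z Az; rewrite subrK leNgt; apply/negP => zr; apply: xA.
  by exists z.
apply: bigcup_measurable => n _; apply: measurableC.
apply: measurable_open => x [e e0 xA]; exists (e / 2); first by rewrite divr_gt0.
move=> y /ball /= yx; exists (e / 2); first by rewrite divr_gt0.
by move=> z Az; have := xA z Az; have := tri z y x; move: yx e0; move: n.+1%:R^-1 => t; lra.
Qed.

Lemma measurable_fwd_nbhd (A : set X) (r : R) :
  measurable (fwd_nbhd d A r : set (borelType d k)).
Proof.
rewrite fwd_nbhdE; apply: measurable_nbhd; first exact: (imetric_triangle dm).
by case: (k) => /=; [left|right|left] => x e y //=; rewrite gt_max => /andP[].
Qed.

Lemma measurable_bwd_nbhd (A : set X) (r : R) :
  measurable (bwd_nbhd d A r : set (borelType d k)).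
Proof.
rewrite bwd_nbhdE; apply: (@measurable_nbhd (fun x y => d y x)).
  by move=> x y z; rewrite addrC; exact: (imetric_triangle dm).
by case: (k) => /=; [right|left|left] => x e y //=; rewrite gt_max => /andP[].
Qed.

End measurability.

(* Main.v *)
(* Let m be a median of a 1-Lipschitz function f. The forward r-neighbourhood
   of {f <= m} lies in {f < m + r} and the backward r-neighbourhood of {m <= f}
   lies in {m - r < f}, so P(|f - m| >= r) is at most twice the concentration
   function, uniformly in f. Summing this Gaussian tail over unit shells bounds
   the moments of f - m, and Minkowski's inequality replaces m by the mean. *)
From HB Require Import structures.
Require Import Defs.
From mathcomp Require Import all_boot all_order all_algebra.
From mathcomp Require Import all_classical all_reals all_analysis.
From mathcomp Require Import measurable_realfun ring lra.

Set Implicit Arguments.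
Unset Strict Implicit.
Unset Printing Implicit Defensive.

Import Order.TTheory GRing.Theory Num.Theory.
Import numFieldNormedType.Exports.

Local Open Scope classical_set_scope.
Local Open Scope ring_scope.

Section probability.
Context d (T : measurableType d) (R : realType) (P : probability T R).

(** * Distribution functions and existence of a median *)

Lemma measurable_le_fun (f : T -> R) (t : R) :
  measurable_fun setT f -> measurable [set x | (f x <= t)%R].
Proof.
move=> mf; rewrite -[X in measurable X]setTI.
rewrite (_ : [set x | (f x <= t)%R] = f @^-1` `]-oo, t]); first exact: mf.
by apply/seteqP; split => x /=; rewrite in_itv.
Qed.

Lemma measurable_ge_fun (f : T -> R) (t : R) :
  measurable_fun setT f -> measurable [set x | (t <= f x)%R].
Proof.
move=> mf; rewrite -[X in measurable X]setTI.
rewrite (_ : [set x | (t <= f x)%R] = f @^-1` `[t, +oo[); first exact: mf.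
by apply/seteqP; split => x /=; rewrite in_itv/= andbT.
Qed.

Lemma exists_cdf (f : T -> R) : measurable_fun setT f ->
  exists X : {RV P >-> R}, forall t, cdf X t = P [set x | (f x <= t)%R].
Proof.
move=> mf.
pose X : {RV P >-> R} := HB.pack f (isMeasurableFun.Build _ _ _ _ f mf).
by exists X.
Qed.

(** Right continuity of the distribution function; it carries a bound down to an infimum, which need
    not be attained a priori. *)
Lemma le_prob_right_limit (f : T -> R) (m a : R) : measurable_fun setT f ->
  (forall t, m < t -> (a%:E <= P [set x | (f x <= t)%R])%E) ->
  (a%:E <= P [set x | (f x <= m)%R])%E.
Proof.
move=> mf mt.
have [X XE] := exists_cdf mf.
rewrite -XE.
apply: (@cvge_ge _ _ _ _ _ _ a%:E _ (@cdf_right_continuous _ _ _ _ X m)).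
near=> t; rewrite XE; apply: mt.
by near: t; exact: nbhs_right_gt.
Unshelve. all: by end_near. Qed.

(** The median is the infimum of the levels where the distribution function is at least 1/2. The
    limits 1 and 0 at the two infinities make this set nonempty and bounded below. *)
Lemma exists_median (f : T -> R) : measurable_fun setT f ->
  exists m, ((2^-1)%:E <= P [set x | (f x <= m)%R])%E /\
            ((2^-1)%:E <= P [set x | (m <= f x)%R])%E.
Proof.
move=> mf.
have [X XE] := exists_cdf mf.
pose S := [set t | ((2^-1)%:E <= cdf X t)%E].
have S0 : S !=set0.
  have h : ((2^-1)%:E < (1 : \bar R))%E by rewrite lte_fin invf_lt1// ltr1n.
  have /filter_ex[t /= tS] : \forall t \near +oo%R, ((2^-1)%:E < cdf X t)%E.
    exact: (cvg_cdfy1 X) _ (open_ereal_gt_ereal h).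
  by exists t; exact: ltW.
have Slb : has_lbound S.
  have h : ((0 : \bar R) < (2^-1)%:E)%E by rewrite lte_fin invr_gt0.
  have /filter_ex[t /= tS] : \forall t \near -oo%R, (cdf X t < (2^-1)%:E)%E.
    exact: (cvg_cdfNy0 X) _ (open_ereal_lt_ereal h).
  exists t => s Ss; rewrite leNgt; apply/negP => st.
  have := cdf_nondecreasing X (ltW st).
  by move=> /(le_trans Ss) /le_lt_trans /(_ tS); rewrite ltxx.
exists (inf S); split.
  apply: le_prob_right_limit => // t /(inf_lt S0)[s Ss st].
  by rewrite -XE; apply: (le_trans Ss); exact/cdf_nondecreasing/ltW.
(* The upper half follows by applying right continuity to [- f]: if [- inf S < t], then [- t] lies
   below [inf S], so [f <= - t] has probability less than 1/2 and its complement more than 1/2. *)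
rewrite (_ : [set x | _] = [set x | (- f x <= - inf S)%R]); last first.
  by apply/seteqP; split => x /=; rewrite lerN2.
apply: le_prob_right_limit => [|t tm]; first exact: measurableT_comp.
have nS : ~ S (- t).
  by move=> /(inf_lbound Slb); rewrite leNgt ltrNl tm.
rewrite (_ : [set x | _] = [set x | (- t <= f x)%R]); last first.
  by apply/seteqP; split => x /=; rewrite lerNl.
have h : (P [set x | (f x <= - t)%R] < (2^-1)%:E)%E.
  by rewrite -XE ltNge; exact/negP.
have mt : measurable [set x | (f x <= - t)%R] by exact: measurable_le_fun.
apply: (@le_trans _ _ (P (~` [set x | (f x <= - t)%R]))).
  rewrite probability_setC// leeBrDr ?fin_num_measure//.
  rewrite [leRHS](_ : _ = (2^-1)%:E + (2^-1)%:E)%E.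
    by rewrite leeD2l// ltW.
  by rewrite -EFinD; congr EFin; lra.
apply: le_measure; rewrite ?inE; [exact: measurableC|exact: measurable_ge_fun|].
by move=> x /= /negP; rewrite -ltNge => /ltW.
Qed.

(** * Moments of a function with a Gaussian tail *)

Lemma powR_mul_expRN_le (q c : R) (n : nat) : 0 <= q -> 0 < c ->
  n.+1%:R `^ q * expR (- (c * n%:R ^+ 2))
    <= expR ((q + 1) ^+ 2 / (4 * c)) / (2 ^ n)%:R.
Proof.
move=> q0 c0.
have n1 : n.+1%:R `^ q <= expR (n%:R * q).
  rewrite expRM; apply: ge0_ler_powR; rewrite ?nnegrE// ?expR_ge0//.
  by rewrite -natr1 addrC expR_ge1Dx.
have n2 : (2 ^ n)%:R <= expR n%:R :> R.
  rewrite -[X in expR X]mulr1 expRM_natl natrX.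
  by rewrite lerXn2r ?nnegrE ?expR_ge0//; have := expR_ge1Dx (1 : R); lra.
rewrite ler_pdivlMr ?ltr0n ?expn_gt0//.
apply: (@le_trans _ _ (expR (n%:R * q) * expR (- (c * n%:R ^+ 2)) * expR n%:R)).
  apply: ler_pM => //.
  by rewrite ler_wpM2r ?expR_ge0.
(* Since both [n + 1] and [2 ^ n] are at most [expR n], what remains is
   [(q + 1) n - c n^2 <= (q + 1)^2 / (4 c)], proved by completing the square. *)
rewrite -!expRD ler_expR -subr_ge0.
rewrite (_ : _ - _ = ((q + 1) - 2 * c * n%:R) ^+ 2 / (4 * c)).
  by rewrite divr_ge0 ?sqr_ge0// mulr_ge0// ltW.
by field; rewrite gt_eqF.
Qed.

Lemma moment_of_gaussian_tail (g : T -> R) (C c q : R) :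
  measurable_fun setT g -> 0 <= C -> 0 < c -> 0 <= q ->
  (forall r : R, 0 < r ->
    (P [set x | (r <= `|g x|)%R] <= (C * expR (- (c * r ^+ 2)))%:E)%E) ->
  (\int[P]_x (`|g x| `^ q)%:E
    <= (2 * (1 + C) * expR ((q + 1) ^+ 2 / (4 * c)))%:E)%E.
Proof.
move=> mg C0 c0 q0 tail.
have mng : measurable_fun setT (fun x => `|g x|) by exact: measurableT_comp.
pose A n := [set x | (n%:R <= `|g x|)%R].
have mA n : measurable (A n) by exact: measurable_ge_fun.
(* Indicators of the superlevel sets [A n], rather than of the shells, let the tail hypothesis apply
   directly. *)
pose F n x : \bar R := ((n.+1%:R `^ q)%:E * (\1_(A n) x)%:E)%E.
have F0 n x : (0 <= F n x)%E by rewrite mule_ge0// lee_fin ?powR_ge0.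
have mF n : measurable_fun setT (F n).
  apply: measurable_funeM; apply/measurable_EFinP.
  exact: measurable_indic.
apply: (@le_trans _ _ (\int[P]_x \sum_(0 <= n <oo) F n x)%E).
  apply: ge0_le_integral => //.
  - apply/measurable_EFinP.
    exact: (measurableT_comp (measurable_powR q) mng).
  - exact: (ge0_emeasurable_sum (P := xpredT)).
  (* With [n] the integer part of [|g x|], the single term [F n x] already dominates, because
     [|g x| < n + 1]. *)
  - move=> x _; pose n := Num.trunc `|g x|.
    have /andP[gn gn1] := truncn_itv (normr_ge0 (g x)).
    apply: (@le_trans _ _ (F n x)).
      rewrite /F indicE mem_set// mule1 lee_fin.
      by apply: ge0_ler_powR; rewrite ?nnegrE// ltW.
    apply: le_trans (nneseries_lim_ge n.+1 _) => //.
    by rewrite big_nat_recr//= leeDr// sume_ge0.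
rewrite integral_nneseries//.
set K := expR _.
(* Comparison with a geometric series of terms [eps / 2 ^ (n + 1)]; starting at exponent 1 accounts
   for the factor 2 in the bound. *)
apply: le_trans (epsilon_trick0 xpredT _); last first.
  by rewrite !mulr_ge0 ?expR_ge0// addr_ge0.
apply: lee_nneseries => [n _ _|n _]; first exact: integral_ge0.
rewrite ge0_integralZl_EFin ?powR_ge0//; last first.
  exact/measurable_EFinP/measurable_indic.
rewrite integral_indic// setIT.
(* The tail bound is only given for positive radii, so [n = 0] uses that a probability is at most 1;
   [1 + C] covers both cases. *)
have PA : (P (A n) <= ((1 + C) * expR (- (c * n%:R ^+ 2)))%:E)%E.
  have [->|n0] := eqVneq n 0%N.
    rewrite expr0n/= mulr0 oppr0 expR0 mulr1.
    by apply: (le_trans (probability_le1 P (mA 0%N))); rewrite lee_fin lerDl.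
  apply: (le_trans (tail n%:R _)); first by rewrite ltr0n lt0n.
  by rewrite lee_fin ler_wpM2r ?expR_ge0// lerDr.
apply: (le_trans (lee_wpmul2l _ PA)); first by rewrite lee_fin powR_ge0.
rewrite -EFinM lee_fin expnS natrM mulrCA.
have -> : 2 * (1 + C) * K / (2 * (2 ^ n)%:R) = (1 + C) * (K / (2 ^ n)%:R).
  by field; rewrite pnatr_eq0 expn_eq0.
by rewrite ler_wpM2l ?addr_ge0// powR_mul_expRN_le.
Qed.

(** * Replacing an arbitrary centre by the mean *)

Lemma Lnorm_cst (a q : R) : q != 0 -> ('N[P]_(q%:E)[EFin \o cst a] = `|a|%:E)%E.
Proof.
move=> q0; rewrite unlock /=.
rewrite integral_cst// [X in (_ * X)%E]probability_setT mule1 /=.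
by rewrite -powRrM mulfV// powRr1.
Qed.

(** Centring at the mean subtracts from [f - m] its own mean, a constant whose norm is at most the
    first absolute moment of [f - m]. Finiteness of that moment ensures that the real integral of
    [f] is the true mean and not a default value. *)
Lemma Lnorm_centered_le (f : T -> R) (m q : R) : measurable_fun setT f ->
  1 <= q -> (\int[P]_x `|(f x - m)%:E| < +oo)%E ->
  ('N[P]_(q%:E)[EFin \o (fun x => f x - \int[P]_y f y)%R] <=
    'N[P]_(q%:E)[EFin \o (fun x => f x - m)%R] + \int[P]_x `|(f x - m)%:E|)%E.
Proof.
move=> mf q1 fm.
have mfm : measurable_fun setT (fun x => f x - m) by exact: measurable_funB.
have ifm : P.-integrable setT (EFin \o (fun x => f x - m)).
  by apply/integrableP; split => //; exact/measurable_EFinP.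
have im : P.-integrable setT (EFin \o (fun=> m)).
  exact: finite_measure_integrable_cst.
have Ef : \int[P]_y f y = \int[P]_y (f y - m) + m.
  rewrite (_ : \int[P]_y f y = \int[P]_y ((f y - m) + m)).
    rewrite RintegralD// Rintegral_cst//.
    by rewrite [X in fine X]probability_setT/= mulr1.
  by apply: eq_Rintegral => x _; rewrite subrK.
rewrite (_ : (fun x => f x - \int[P]_y f y) =
    (fun x => f x - m) \+ cst (- \int[P]_y (f y - m))); last first.
  by apply/funext => x /=; rewrite Ef; lra.
apply: (le_trans (minkowski_EFin _ _ _ _)) => //.
rewrite leeD2l// Lnorm_cst; last by rewrite gt_eqF// (lt_le_trans _ q1).
rewrite normrN EFin_normr_Rintegral//.
by apply: le_abse_integral => //; exact/measurable_EFinP.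
Qed.

End probability.

(** * Deviation from the median through the concentration function *)

Section concentration_tail.
Context (R : realType) (X : pointedType) (d : X -> X -> R) (k : ball_kind).
Variable mu : probability (borelType d k) R.
Hypothesis dm : irreversible_metric d.

Lemma le_concentration (A : set (borelType d k)) (r : R) :
  measurable A -> ((2^-1)%:E <= mu A)%E ->
  (mu (~` fwd_nbhd d A r) <= concentration mu r)%E /\
  (mu (~` bwd_nbhd d A r) <= concentration mu r)%E.
Proof.
move=> mA A2.
have le_sup : (1 - Order.min (mu (fwd_nbhd d A r)) (mu (bwd_nbhd d A r))
    <= concentration mu r)%E.
  by apply: ereal_sup_ubound; exists A.
split.
  rewrite probability_setC; last exact: measurable_fwd_nbhd.
  by apply: le_trans le_sup; rewrite leeB// ge_min lexx.
rewrite probability_setC; last exact: measurable_bwd_nbhd.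
by apply: le_trans le_sup; rewrite leeB// ge_min lexx orbT.
Qed.

Lemma tail_le_concentration (f : borelType d k -> R) (m r : R) :
  ilipschitz d 1 f ->
  ((2^-1)%:E <= mu [set x | (f x <= m)%R])%E ->
  ((2^-1)%:E <= mu [set x | (m <= f x)%R])%E ->
  (mu [set x | (r <= `|f x - m|)%R]
    <= concentration mu r + concentration mu r)%E.
Proof.
move=> fL le_m ge_m.
have mf : measurable_fun setT f by exact: (measurable_ilipschitz ltr01 fL).
have mle : measurable [set x | (f x <= m)%R] by exact: measurable_le_fun.
have mge : measurable [set x | (m <= f x)%R] by exact: measurable_ge_fun.
(* The Lipschitz condition is one-sided, so the sublevel set is paired with its forward
   neighbourhood and the superlevel set with its backward one. *)
have [U _] := le_concentration r mle le_m.
have [_ V] := le_concentration r mge ge_m.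
have mU := @measurable_fwd_nbhd _ _ _ k dm [set x | (f x <= m)%R] r.
have mV := @measurable_bwd_nbhd _ _ _ k dm [set x | (m <= f x)%R] r.
apply: le_trans (leeD U V).
apply: le_trans (measureU2 mu (measurableC mU) (measurableC mV)).
apply: le_measure; rewrite ?inE.
- apply: measurable_ge_fun; apply: measurableT_comp => //.
  exact: measurable_funB.
- by apply: measurableU; exact: measurableC.
(* A point in both neighbourhoods satisfies [m - r < f x < m + r]. *)
move=> x /= rx; apply: contrapT => /not_orP[/contrapT + /contrapT].
rewrite fwd_nbhdE bwd_nbhdE => -[y /= ym yx] [z /= mz xz].
move: rx; apply/negP; rewrite -ltNge ltr_norml.
have := fL y x; have := fL x z.
by rewrite !mul1r; lra.
Qed.

End concentration_tail.

(** * Moment concentration of 1-Lipschitz functions *)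

Theorem theorem3p7 (R : realType) (X : pointedType) (d : X -> X -> R)
    (hd : irreversible_metric d) (k : ball_kind)
    (mu : probability (borelType d k) R)
    (hmu : normal_concentration mu) (q : R) (hq : 1 <= q) :
  moment_concentration mu 2 q.
Proof.
case: hmu => C [c [C0 c0 conc]].
have q0 : 0 < q by exact: lt_le_trans hq.
(* [K s] bounds the moment of order [s] about the median; [2 * C] comes from adding the two
   one-sided tails. *)
pose K s : R := 2 * (1 + 2 * C) * expR ((s + 1) ^+ 2 / (4 * c)).
have K0 s : 0 < K s by rewrite !mulr_gt0 ?expR_gt0// addr_gt0// mulr_gt0.
(* The two summands bound the two Minkowski terms: the norm of [f - m] and its first absolute
   moment. *)
pose M := K q `^ q^-1 + K 1.
have M0 : 0 < M by rewrite addr_gt0 ?powR_gt0.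
(* Chosen so that [q] divided by this constant is exactly [M ^+ 2]; it depends on [q] but not on
   [f]. *)
exists (q / M ^+ 2); first by rewrite divr_gt0// exprn_gt0.
move=> f fL.
have mf : measurable_fun setT (f : borelType d k -> R).
  exact: (measurable_ilipschitz ltr01 fL).
have [m [le_m ge_m]] := exists_median mu mf.
have mfm : measurable_fun setT (fun x : borelType d k => f x - m).
  exact: measurable_funB.
have moment s : 0 <= s -> (\int[mu]_x (`|f x - m| `^ s)%:E <= (K s)%:E)%E.
  move=> s0; apply: moment_of_gaussian_tail => //; first by rewrite mulr_ge0// ltW.
  move=> r r0; apply: (le_trans (tail_le_concentration hd r fL le_m ge_m)).
  apply: (le_trans (leeD (conc _ r0) (conc _ r0))).
  by rewrite -EFinD lee_fin -mulrDl -mulr2n mulr_natl.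
have moment1 : (\int[mu]_x `|(f x - m)%:E| <= (K 1)%:E)%E.
  apply: le_trans (moment 1 ler01); rewrite le_eqVlt; apply/predU1P; left.
  by apply: eq_integral => x _; rewrite powRr1.
have NM : ('N[mu]_(q%:E)[EFin \o (fun x => f x - \int[mu]_y f y)%R] <= M%:E)%E.
  apply: (le_trans (Lnorm_centered_le mf hq _)).
    exact: (le_lt_trans moment1 (ltry _)).
  rewrite EFinD leeD// -poweR_EFin unlock.
  apply: gt0_ler_poweR.
  - by rewrite invr_ge0 ltW.
  - by rewrite in_itv/= leey andbT; apply: integral_ge0 => x _;
      rewrite lee_fin powR_ge0.
  - by rewrite in_itv/= leey andbT lee_fin ltW.
  - exact: moment (ltW q0).
apply: (@le_trans _ _ (M%:E `^ 2)%E).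
  apply: gt0_ler_poweR => //;
    by rewrite ?in_itv/= ?leey ?andbT ?Lnorm_ge0 ?lee_fin ?ltW.
rewrite poweR_EFin lee_fin powR_mulrn; last exact: ltW.
have qn0 : q != 0 by rewrite gt_eqF.
by rewrite invf_div [q * _]mulrC divfK.
Qed.
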